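(* Let $G$ be a planar triangulation on at least five vertices such that $G$ has a proper edge-coloring containing no rainbow $C_4$. Then $G$ has minimum degree $5$ and $G$ is $4$-connected.
   Context: All graphs are finite and simple. A planar triangulation is an edge-maximal planar graph (every face of a plane embedding is bounded by a triangle). A proper edge-coloring assigns colors to edges so that edges sharing an endpoint get different colors. An edge-colored subgraph is rainbow if no two of its edges have the same color. $C_4$ denotes the cycle on four vertices; ''containing no rainbow $C_4$'' means no subgraph isomorphic to $C_4$ is rainbow under the coloring. *)

(* Defs.v *)
From mathcomp Require Import all_boot all_fingroup.

Set Implicit Arguments.
Unset Strict Implicit.
Unset Printing Implicit Defensive.

(* A finite simple graph is a symmetric irreflexive adjacency relation on a   *)
(* finite type of vertices; its edges are two-element sets of vertices.       *)
Section Graphs.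

Variable T : finType.
Implicit Types (e : rel T) (S : {set T}) (r : T -> {perm T}).

Definition simple_graph e := symmetric e /\ irreflexive e.

Definition arcs e : {set T * T} := [set d | e d.1 d.2].

Definition edges e : {set {set T}} := [set [set d.1; d.2] | d in arcs e].

Definition deg e (v : T) := #|[set u | e v u]|.

Definition isolated e : {set T} := [set v | deg e v == 0].

Definition min_degree_is e k :=
  (forall v, k <= deg e v) /\ (exists v, deg e v = k).

Definition remove_vertices e S : rel T :=
  [rel x y | [&& x \notin S, y \notin S & e x y]].

Definition k_connected k e :=
  k < #|T| /\
  forall S, #|S| < k ->
    forall u v, u \notin S -> v \notin S -> connect (remove_vertices e S) u v.

(* Embeddings in the plane are combinatorial maps.  A drawing on an oriented  *)
(* surface is given, up to homeomorphism, by a rotation system: for each      *)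
(* vertex v, the cyclic order r v of the neighbours of v around v (the values *)
(* of r v outside the neighbourhood of v play no role).                       *)
Definition rotation_system e r :=
  forall v u w, e v u -> (w \in porbit (r v) u) = e v w.

(* Face tracing: a facial walk that traverses the arc from u to v leaves v    *)
(* through the neighbour that follows u in the rotation at v.                 *)
Definition face_step r (d : T * T) : T * T := (d.2, r d.2 d.1).

(* An isolated vertex has no arc, but it is the whole boundary of the unique  *)
(* face of its own component; hence the second summand.                       *)
Definition faces e r := fcard (face_step r) (arcs e) + #|isolated e|.

(* Euler's formula V - E + F = 2, summed over the connected components.  On   *)
(* each component V - E + F = 2 - 2g <= 2, so the sum is attained exactly     *)
(* when every component is drawn on the sphere.                               *)
Definition plane_embedding e r :=
  rotation_system e r /\ #|T| + faces e r = #|edges e| + 2 * n_comp e T.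

Definition planar e := exists r, plane_embedding e r.

Definition planar_triangulation e :=
  planar e /\
  forall e' : rel T, simple_graph e' -> subrel e e' -> planar e' -> e' =2 e.

Definition proper_edge_coloring (C : eqType) e (c : {set T} -> C) :=
  forall E F, E \in edges e -> F \in edges e ->
    E != F -> E :&: F != set0 -> c E != c F.

Definition is_C4 e (a b c d : T) :=
  uniq [:: a; b; c; d] /\ [&& e a b, e b c, e c d & e d a].

Definition rainbow_C4 (C : eqType) e (col : {set T} -> C) (a b c d : T) :=
  is_C4 e a b c d /\
  uniq [:: col [set a; b]; col [set b; c]; col [set c; d]; col [set d; a]].

Definition has_rainbow_C4 (C : eqType) e (col : {set T} -> C) :=
  exists a b c d, rainbow_C4 e col a b c d.

End Graphs.

(* Main.v *)
(* Deleting an edge multiplies the face permutation by a few transpositions,  *)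
(* so it never increases the defect E + 2c - V - F.  Hence every rotation     *)
(* system has nonnegative defect and the drawings of subgraphs of plane       *)
(* graphs are plane.  Conversely, joining two components, or two vertices of  *)
(* one face, keeps a drawing plane; so an edge-maximal planar graph is        *)
(* connected and two vertices of a face are adjacent.  A face of length at    *)
(* least four would then give a plane drawing of K4 with a non-triangular     *)
(* face.  Therefore all faces are triangles and the link of each vertex is a  *)
(* cycle.                                                                     *)
(*                                                                            *)
(* Without a rainbow C4, every C4 has two opposite edges of the same colour.  *)
(* In a K4 two of the three perfect matchings are then monochromatic, which   *)
(* forbids any further common neighbour along the third matching; hence all   *)
(* four triangles of the K4 are faces and the graph is K4.  So there is no    *)
(* K4, and no vertex of degree 3; degree 4 is excluded by chasing colours     *)
(* around the wheel, and Euler's formula gives a vertex of degree at most 5.  *)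
(* If a triangle abp were not a face, the colour of ap would occur at b on an *)
(* edge to a common neighbour of a and b, and on an edge to a common          *)
(* neighbour of b and p, that is, on a single edge completing a K4: so every  *)
(* triangle is a face.  Finally, each vertex s of a minimal separator S has   *)
(* neighbours on both sides, so its link meets S in two vertices separating   *)
(* them; if |S| <= 3, then S is a triangle, which is a face, so these two     *)
(* vertices are consecutive in the link and separate nothing.                 *)

Require Import Defs.
From mathcomp Require Import all_boot all_fingroup.
From mathcomp Require Import zify.

Set Implicit Arguments.
Unset Strict Implicit.
Unset Printing Implicit Defensive.


(** Planarity enters as zero Euler defect E + 2c - V - F. Deleting an edge multiplies [face_perm] by
    transpositions, and [faces_del] with [n_comp_del] shows that the defect does not grow. It
    vanishes for the empty graph, so it is never negative ([euler_le]), and zero defect passes to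
    subgraphs ([subgraph_euler]). Read backwards, the same count permits a new edge between
    components or inside a face, so edge-maximality gives [triangulation_connected] and
    [cofacial_adj], and then [face_triangle].

    The colouring enters through [C4_opposite]. It yields [no_K4] and the 4-wheel exclusion
    [rot4_neq], hence [deg_ge5], while [ex_deg_lt6] supplies a vertex of degree exactly 5. With
    [no_K4] it also makes every triangle a face ([triangle_facial]), and a minimal separator of at
    most three vertices would be a non-facial triangle ([small_set_not_separating]). *)

(** * Cycles of permutations *)

Section Orbits.

Variable T : finType.
Implicit Types (s : {perm T}) (e : rel T) (a x y z : T).

Lemma porbit_ind s (Q : T -> Prop) x y :
  Q x -> (forall z, Q z -> Q (s z)) -> y \in porbit s x -> Q y.
Proof.
move=> Qx QS /porbitP[i ->]; elim: i => [|i IHi]; first by rewrite expg0 perm1.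
by rewrite expgSr permM; apply: QS.
Qed.

Lemma porbitS s x z : z \in porbit s x -> s z \in porbit s x.
Proof.
by rewrite -!eq_porbit_mem => /eqP<-; rewrite -[s]expg1 porbit_perm.
Qed.

Lemma porbit1 s x : s x \in porbit s x.
Proof. by apply/porbitS/porbit_id. Qed.

Lemma porbit_trans s x y z :
  x \in porbit s y -> y \in porbit s z -> x \in porbit s z.
Proof. by rewrite -!eq_porbit_mem => /eqP-> /eqP->. Qed.

Lemma porbit_sub s s' x y :
  (forall z, s z \in porbit s' z) -> y \in porbit s x -> y \in porbit s' x.
Proof.
move=> ss'; apply: (porbit_ind (Q := fun y => y \in porbit s' x)) => [|z].
  exact: porbit_id.
exact: porbit_trans.
Qed.

(** Cuts [a] out of its cycle and leaves it fixed; on a rotation this deletes one neighbour. *)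
Definition skip a s : {perm T} := (s * tperm a (s a))%g.

Lemma skipE a s x :
  skip a s x = if x == a then a else if s x == a then s a else s x.
Proof.
rewrite permM; have [->|xa] := eqVneq x a; first by rewrite tpermR.
have [->|sxa] := eqVneq (s x) a; first by rewrite tpermL.
by rewrite tpermD // eq_sym // (inj_eq perm_inj).
Qed.

(** The same permutation is [s] multiplied by the transposition of [a] and its predecessor; both lie
    on one cycle, which splits unless they coincide. *)
Lemma card_porbits_skip a s :
  #|porbits (skip a s)| = #|porbits s| + (s a != a).
Proof.
have -> : skip a s = (tperm (s^-1 a) a * s)%g.
  apply/permP=> x; rewrite skipE permM.
  have [->|xa] := eqVneq x a; first by rewrite tpermR permKV.
  have [<-|sxa] := eqVneq (s x) a; first by rewrite permK tpermL.
  by rewrite tpermD // ?(canF_eq (permKV s)) eq_sym.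
have := porbits_mul_tperm s (s^-1%g a) a; rewrite /=.
have -> : s^-1%g a \in porbit s a by rewrite -porbitV; apply: porbit1.
by rewrite addn0 => ->; rewrite (canF_eq (permKV s)) eq_sym.
Qed.

Lemma fconnect_porbit s x y : fconnect s x y = (y \in porbit s x).
Proof.
apply/idP/porbitP => [/iter_findex <-|[i ->]].
  by exists (findex s x y); rewrite permX.
by rewrite permX fconnect_iter.
Qed.

Lemma card_porbits s : #|porbits s| = fcard s T.
Proof.
transitivity #|porbit s @: [predI froots s & T]|; last first.
  rewrite card_in_imset // => x y /andP[/eqP rx _] /andP[/eqP ry _] /eqP.
  rewrite eq_porbit_mem -fconnect_porbit => /(rootP (fconnect_sym perm_inj)).
  by rewrite rx ry.
apply: eq_card => O; apply/imsetP/imsetP => -[x xP ->]; exists (froot s x) => //.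
- by rewrite !inE andbT (roots_root (fconnect_sym perm_inj)).
- by apply/eqP; rewrite eq_porbit_mem porbit_sym -fconnect_porbit connect_root.
by case/andP: xP => /eqP->.
Qed.

Lemma eq_n_comp_in e e' (A : {pred T}) :
  (forall x, x \in A -> connect e x =1 connect e' x) ->
  n_comp e A = n_comp e' A.
Proof.
move=> ee'; apply: eq_card => x; rewrite !inE; apply: andb_id2r => xA.
by rewrite /roots /root (eq_pick (ee' x xA)).
Qed.

End Orbits.


(** * Removing and inserting an element of a cyclic order *)

Section CyclicOrders.

Variable T : finType.
Implicit Types (s : {perm T}) (N : pred T) (x y v w : T).

Lemma porbit_fix s x y : s x = x -> (y \in porbit s x) = (y == x).
Proof.
move=> sx; apply/idP/eqP => [|->]; last exact: porbit_id.
by apply: (porbit_ind (Q := fun z => z = x)) => // z ->.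
Qed.

Lemma skip_mem_porbit s v x : skip v s x \in porbit s x.
Proof.
rewrite skipE; have [->|xv] := eqVneq x v; first exact: porbit_id.
by case: eqP => [<-|_]; do ?apply: porbitS; apply: porbit_id.
Qed.

Lemma porbit_skip s v x y :
  x != v -> y != v -> (y \in porbit (skip v s) x) = (y \in porbit s x).
Proof.
move=> xv yv; apply/idP/idP.
  by apply: porbit_sub => z; apply: skip_mem_porbit.
pose Q z := (if z == v then s v else z) \in porbit (skip v s) x.
suff Qy : y \in porbit s x -> Q y by move=> /Qy; rewrite /Q (negPf yv).
apply: (porbit_ind (Q := Q)) => [|z]; rewrite /Q.
  by rewrite (negPf xv) porbit_id.
have [->|zv] := eqVneq z v; first by rewrite if_same.
by move=> /porbitS; rewrite skipE (negPf zv); case: ifP.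
Qed.

Definition cyclic_on N s := forall x y, N x -> (y \in porbit s x) = N y.

Lemma cyclic_on_skip N s v :
  cyclic_on N s -> cyclic_on (fun w => N w && (w != v)) (skip v s).
Proof.
move=> cs x y /andP[Nx xv]; have [->|yv] := eqVneq y v.
  by rewrite porbit_sym porbit_fix ?skipE ?eqxx // andbF (negPf xv).
by rewrite porbit_skip // cs // andbT.
Qed.

(** The second alternative is the insertion of a first element, which forms a cycle alone. *)
Lemma cyclic_on_unskip N s v :
  ~~ N v -> cyclic_on N (skip v s) ->
  N (s v) \/ s v = v /\ (forall w, ~~ N w) ->
  cyclic_on (fun w => N w || (w == v)) s.
Proof.
move=> Nv cs [Nsv|[sv N0]] x y.
  have vx z : N z -> v \in porbit s z.
    move=> Nz; have zv : z != v by apply: contraNneq Nv => <-.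
    have svv : s v != v by apply: contraNneq Nv => <-.
    rewrite porbit_sym; apply: porbit_trans (porbit1 s v).
    by rewrite -(@porbit_skip s v) ?cs.
  have h z w : N z -> (w \in porbit s z) = N w || (w == v).
    move=> Nz; have zv : z != v by apply: contraNneq Nv => <-.
    have [->|wv] := eqVneq w v; first by rewrite orbT vx.
    by rewrite orbF -(@porbit_skip s v) ?cs.
  case: (boolP (N x)) => [Nx _|_ /= /eqP->]; first exact: h.
  have /eqP-> : porbit s v == porbit s (s v) by rewrite eq_porbit_mem vx.
  exact: h.
by rewrite (negPf (N0 x)) (negPf (N0 y)) => /eqP->; apply: porbit_fix.
Qed.

End CyclicOrders.

(** * Rotation systems as permutations of arcs; counting arcs and faces *)

Section Maps.

Variable T : finType.
Implicit Types (e : rel T) (r : T -> {perm T}).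

(* The values of a rotation outside the neighbourhoods are irrelevant; fixing *)
(* them makes non-arcs into fixed points of the face permutation.             *)
Definition reduced_rotation e r :=
  rotation_system e r /\ forall v u, ~~ e v u -> r v u = u.

Lemma rotation_nbr e r v u : rotation_system e r -> e v (r v u) = e v u.
Proof.
move=> hr; apply/idP/idP => [evru|evu].
  by rewrite -(hr _ _ u evru) porbit_sym porbit1.
by rewrite -(hr _ _ _ evu) porbit1.
Qed.

Lemma reduce_rotation e r : rotation_system e r ->
  exists2 r0, reduced_rotation e r0 & forall v u, e v u -> r v u = r0 v u.
Proof.
move=> hr; pose f v u := if e v u then r v u else u.
have f_inj v : injective (f v).
  move=> x y; rewrite /f; case: ifP => ex; case: ifP => ey.
  - exact: perm_inj.
  - by move=> xy; rewrite -xy rotation_nbr ?ex in ey.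
  - by move=> xy; rewrite xy rotation_nbr ?ey in ex.
  - by [].
exists (fun v => perm (f_inj v)); last by move=> v u; rewrite permE /f => ->.
split=> [v u w evu|v u /negPf]; last by rewrite permE /f => ->.
rewrite -(hr _ _ _ evu); apply/idP/idP.
  apply: (porbit_ind (Q := fun z => z \in porbit (r v) u)) => [|z zu].
    exact: porbit_id.
  by rewrite permE /f; case: ifP => // _; apply: porbitS.
move=> wu; suff /andP[]: (w \in porbit (perm (f_inj v)) u) && e v w by [].
move: wu; apply: (porbit_ind (Q := fun z => _ && e v z)) => [|z].
  by rewrite porbit_id.
move=> /andP[/porbitS]; rewrite permE /f => + evz.
by rewrite evz rotation_nbr // evz => ->.
Qed.

(** Testing both directions makes this an involution for every [e], symmetric or not. *)
Definition swap_arc e (d : T * T) :=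
  if e d.1 d.2 && e d.2 d.1 then (d.2, d.1) else d.

Lemma swap_arcK e : involutive (swap_arc e).
Proof.
move=> [x y]; rewrite /swap_arc /=.
by case exy: (e x y && e y x); rewrite /= ?[e y x && _]andbC exy.
Qed.

Definition turn r (d : T * T) := (d.1, r d.1 d.2).

Lemma turn_inj r : injective (turn r).
Proof. by move=> [x y] [x' y'] [-> /perm_inj->]. Qed.

(** Edge reversal followed by the turn at a vertex; deleting an edge changes each factor by
    transpositions. *)
Definition face_perm e r : {perm T * T} :=
  (perm (inv_inj (swap_arcK e)) * perm (turn_inj (r := r)))%g.

Lemma face_permE e r d : symmetric e -> reduced_rotation e r ->
  face_perm e r d = if e d.1 d.2 then face_step r d else d.
Proof.
move=> es [_ hr]; rewrite permM !permE /swap_arc [e d.2 d.1]es andbb.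
case: ifP => // ed; case: d ed => x y /= ed.
by rewrite /turn /= hr ?ed.
Qed.

Lemma face_perm_arc e r d : symmetric e -> reduced_rotation e r ->
  (face_perm e r d \in arcs e) = (d \in arcs e).
Proof.
move=> es hr; rewrite face_permE // !inE; case: ifP => //= ed.
by rewrite (rotation_nbr _ _ hr.1) es.
Qed.

(** Every non-arc is a fixed point of [face_perm], hence one extra cycle. *)
Lemma facesE e r r0 : symmetric e -> reduced_rotation e r0 ->
  (forall v u, e v u -> r v u = r0 v u) ->
  faces e r + #|~: arcs e| = #|porbits (face_perm e r0)| + #|isolated e|.
Proof.
move=> es hr0 rr0; rewrite card_porbits (n_compC (mem (arcs e))).
have -> : fcard (face_perm e r0) [predC mem (arcs e)] = #|~: arcs e|.
  apply: eq_card => d; rewrite !inE; apply: andb_idl => ed.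
  have fd: face_perm e r0 d = d by rewrite face_permE // (negPf ed).
  apply/eqP; have := connect_root (frel (face_perm e r0)) d.
  by rewrite fconnect_porbit porbit_fix // => /eqP.
suff E : fcard (face_step r) (arcs e) = fcard (face_perm e r0) (arcs e).
  by rewrite /faces E addnAC.
apply: eq_n_comp_in => d ed.
have it n : iter n (face_step r) d = iter n (face_perm e r0) d /\
            iter n (face_perm e r0) d \in arcs e.
  elim: n => [//|n [IHn IHe]]; rewrite !iterS face_perm_arc //; split=> //.
  move: IHe; rewrite IHn face_permE // inE => ee; rewrite ee.
  by rewrite /face_step rr0 // es.
move=> d'; apply/idP/idP => /iter_findex <-.
  by rewrite (it _).1 fconnect_iter.
by rewrite -(it _).1 fconnect_iter.
Qed.

Lemma isolatedP e x : reflect (forall y, ~~ e x y) (x \in isolated e).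
Proof.
rewrite inE cards_eq0; apply: (iffP eqP) => [/setP h y|h].
  by have := h y; rewrite !inE => ->.
by apply/setP => y; rewrite !inE (negPf (h y)).
Qed.

Lemma card_arcs e : simple_graph e -> #|arcs e| = 2 * #|edges e|.
Proof.
move=> [es ei]; rewrite -sum1_card (partition_big_imset (fun d => [set d.1; d.2])) /=.
rewrite -/(edges e) mulnC -sum_nat_const; apply: eq_bigr => E.
case/imsetP => -[x y]; rewrite inE /= => exy ->.
have xy : x != y by apply: contraTneq exy => ->; rewrite ei.
rewrite sum1_card; transitivity #|[set (x, y); (y, x)]|; last first.
  by rewrite cards2 xpair_eqE (negPf xy).
apply: eq_card => -[a b]; rewrite unfold_in !inE /= !xpair_eqE.
apply/andP/orP => [[eab /eqP/setP D]|]; last first.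
  case=> /andP[/eqP-> /eqP->]; split=> //; first by rewrite es.
  by apply/eqP/setUC.
have ab : a != b by apply: contraTneq eab => ->; rewrite ei.
have := D a; rewrite !inE eqxx /= => /esym/orP[]/eqP?; subst a.
  by left; have := D b; rewrite !inE eqxx orbT eq_sym (negPf ab) /= => <-; rewrite eqxx.
by right; have := D b; rewrite !inE eqxx orbT [b == y]eq_sym (negPf ab) orbF => <-;
  rewrite eqxx.
Qed.

Lemma card_arcs_deg e : #|arcs e| = \sum_x deg e x.
Proof.
rewrite -sum1_card (partition_big fst predT) //=; apply: eq_bigr => x _.
rewrite sum1_card; transitivity #|pair x @: [set y | e x y]|; last first.
  by rewrite card_imset // => ? ? [].
apply: eq_card => -[a b]; rewrite unfold_in !inE /=.
apply/andP/imsetP => [[eab /eqP<-]|]; first by exists b; rewrite ?inE.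
by case=> y; rewrite inE => exy [-> ->].
Qed.

End Maps.


(** * The effect of deleting one edge on Euler's formula *)

Section Deletion.

Variable T : finType.
Implicit Types (e : rel T) (r : T -> {perm T}).

Definition del_edge e u v : rel T :=
  [rel x y | [&& e x y, ~~ ((x == u) && (y == v)) & ~~ ((x == v) && (y == u))]].

Definition del_rot r u v x : {perm T} :=
  if x == u then skip v (r u) else if x == v then skip u (r v) else r x.

Definition euler_count e := #|edges e| + 2 * n_comp e T.

(** The smaller graph and its rotation are fixed only pointwise, so that the section also serves
    when a given graph is recovered from one with an added edge. *)
Variables (e e' : rel T) (r r' : T -> {perm T}) (u v : T).
Hypotheses (es : symmetric e) (ei : irreflexive e).
Hypotheses (euv : e u v) (e'del : e' =2 del_edge e u v).

Let e'E x y :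
  e' x y = [&& e x y, ~~ ((x == u) && (y == v)) & ~~ ((x == v) && (y == u))].
Proof. exact: e'del. Qed.

Let uv : u != v.
Proof. by apply: contraTneq euv => ->; rewrite ei. Qed.

Let vu : v != u.
Proof. by rewrite eq_sym. Qed.

Let evu : e v u.
Proof. by rewrite es. Qed.

Lemma del_edge_simple : simple_graph e'.
Proof.
split=> [x y|x]; rewrite !e'E /= ?ei // es.
by rewrite [(y == u) && _]andbC [(y == v) && _]andbC; case: (e y x) => //=; rewrite andbC.
Qed.

Let e's := del_edge_simple.1.

Lemma del_edge_sub : subrel e' e.
Proof. by move=> x y; rewrite e'E => /and3P[]. Qed.

Lemma card_arcs_del : #|arcs e| = #|arcs e'| + 2.
Proof.
have -> : arcs e' = arcs e :\ (u, v) :\ (v, u).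
  apply/setP=> -[x y]; rewrite !inE /= e'E /= !xpair_eqE.
  by case: (e x y); rewrite /= ?andbF //= andbT andbC.
rewrite (cardsD1 (u, v)) (cardsD1 (v, u) (_ :\ _)) !inE /= euv evu.
by rewrite xpair_eqE (negPf vu) /= addnA addnC.
Qed.

Lemma card_edges_del : #|edges e| = #|edges e'|.+1.
Proof.
by have := card_arcs_del; rewrite !card_arcs //; [lia|apply: del_edge_simple].
Qed.

(** Let [A] be the union of the [e']-components of [u] and [v]. It is a single component of [e], and
    outside it nothing changes. *)
Lemma n_comp_del : n_comp e' T = n_comp e T + ~~ connect e' u v.
Proof.
have cs := sym_connect_sym es; have cs' := sym_connect_sym e's.
have sub : subrel (connect e') (connect e).
  by apply: connect_sub => x y /del_edge_sub; apply: connect1.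
pose A := closure e' (pred2 u v).
have AE x : (x \in A) = connect e' x u || connect e' x v.
  apply/existsP/orP => [[y]|]; rewrite ?inE.
    by case/andP=> xy /orP[]/eqP<-; [left|right].
  by case=> xy; [exists u|exists v]; rewrite !inE xy eqxx ?orbT.
have Acl : closed e A.
  apply: (intro_closed cs) => x y exy; rewrite !AE => xA.
  case e'xy: (e' x y).
    by move: xA; rewrite !(same_connect1 cs' e'xy).
  move: e'xy; rewrite e'E /= exy /=.
  move/negbT; rewrite negb_and !negbK => /orP[]/andP[_ /eqP->];
    by rewrite connect0 ?orbT.
have AuE : A =i connect e u.
  move=> x; apply/idP/idP; last first.
    by move=> /(closed_connect Acl) <-; rewrite AE connect0.
  have euv' : connect e u v by apply: connect1.
  by rewrite AE => /orP[]/sub; rewrite cs // => /(connect_trans euv').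
rewrite !(n_compC A) /A (n_comp_closure2 cs') -/A.
rewrite (eq_n_comp_r AuE) (n_comp_connect cs).
suff -> : n_comp e' [predC A] = n_comp e [predC A] by lia.
apply: eq_n_comp_in => x xA y; apply/idP/idP; first exact: sub.
case/connectP=> p; elim: p x xA => [|z p IHp] x xA /=; first by move=> _ ->.
case/andP=> exz pz y_z.
have zA : z \in [predC A] by rewrite -(predC_closed Acl exz).
apply: connect_trans (IHp z zA pz y_z); apply: connect1.
rewrite e'E /= exz /= -negb_or; apply: contraNN xA.
by rewrite AE; case/orP => /andP[/eqP-> _]; rewrite connect0 ?orbT.
Qed.

Lemma euler_count_del :
  (euler_count e').+1 = euler_count e + (~~ connect e' u v).*2.
Proof. by rewrite /euler_count n_comp_del card_edges_del; lia. Qed.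

Hypotheses (hr : reduced_rotation e r) (r'E : r' =1 del_rot r u v).

Lemma del_rot_reduced : reduced_rotation e' r'.
Proof.
split=> [x y z|x y].
  rewrite r'E /del_rot !e'E /=.
  have [->|xu] := eqVneq x u.
    rewrite (negPf uv) /= !andbT => y_;
    exact: (cyclic_on_skip (N := e u) (hr.1 u)).
  have [->|xv] := eqVneq x v; last by rewrite !andbT; apply: hr.1.
  move=> /= y_; exact: (cyclic_on_skip (N := e v) (hr.1 v)).
rewrite r'E /del_rot e'E /=; have [->|xu] := eqVneq x u.
  rewrite (negPf uv) /= andbT skipE; have [//|yv] := eqVneq y v.
  by rewrite andbT => /hr.2 ry; rewrite ry (negPf yv).
have [->|xv] := eqVneq x v; last by rewrite !andbT; apply: hr.2.
rewrite /= skipE; have [//|yv] := eqVneq y u.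
by rewrite andbT => /hr.2 ry; rewrite ry (negPf yv).
Qed.

(** The transposition cancels the reversal of the deleted edge; the two skips take its ends out of
    the rotations at [u] and [v]. *)
Lemma face_perm_del :
  face_perm e' r' =
  skip (v, u) (skip (u, v) (tperm (u, v) (v, u) * face_perm e r)%g).
Proof.
set al := (u, v); set be := (v, u); rewrite /skip /face_perm.
set sw := perm (inv_inj (swap_arcK e)); set sw' := perm (inv_inj (swap_arcK e')).
set tu := perm (turn_inj (r := r)); set tu' := perm (turn_inj (r := r')).
have tuE d : tu d = turn r d by rewrite permE.
have tu'E d : tu' d = turn r' d by rewrite permE.
have -> : sw' = (tperm al be * sw)%g.
  apply/permP=> -[x y]; rewrite permM [sw' _]permE [sw _]permE /swap_arc /= !e'E.
  case: tpermP => [[-> ->]|[-> ->]|/eqP + /eqP]; rewrite /= ?euv ?evu ?eqxx ?andbF //.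
  rewrite !xpair_eqE => /negPf d1 /negPf d2; rewrite d1 d2.
  by rewrite [(y == u) && _]andbC [(y == v) && _]andbC d1 d2 !andbT.
have tua : (tperm al be * (sw * tu))%g al = tu al.
  by rewrite !permM tpermL [sw _]permE /swap_arc /= evu euv.
have tub : (tperm al be * (sw * tu))%g be = tu be.
  by rewrite !permM tpermR [sw _]permE /swap_arc /= evu euv.
rewrite tua [in RHS]permM tub.
have tdiff (d1 d2 d3 : T * T) : d1.1 != d3.1 -> d2.1 != d3.1 -> tperm d1 d2 d3 = d3.
  by move=> n1 n2; rewrite tpermD //; [apply: contraNneq n1|apply: contraNneq n2] => ->.
have -> : tperm al (tu al) (tu be) = tu be by rewrite tdiff ?tuE.
rewrite -!mulgA; do 2![congr (_ * _)%g].
have tpair x a b c : tperm (x, a) (x, b) (x, c) = (x, tperm a b c).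
  by rewrite inj_tperm // => ? ? [].
apply/permP=> -[x y]; rewrite !permM !tuE tu'E /turn /= r'E /del_rot.
have [->|xu] := eqVneq x u; first by rewrite tpair permM tdiff.
rewrite [tperm al _ _]tdiff //= 1?eq_sym //.
have [->|xv] := eqVneq x v; first by rewrite tpair permM.
by rewrite tdiff //= eq_sym.
Qed.

Lemma isolated_del x y : (x == u) && (y == v) || (x == v) && (y == u) ->
  (x \in isolated e') = (r x y == y).
Proof.
move=> xy; have exy : e x y by case/orP: xy => /andP[/eqP-> /eqP->].
have e'x z : e' x z = e x z && (z != y).
  rewrite e'E; case/orP: xy => /andP[/eqP-> /eqP->];
    by rewrite eqxx ?(negPf uv) ?(negPf vu) ?andbT.
apply/isolatedP/eqP => [h|rxy z].
  apply/eqP; have := h (r x y); rewrite e'x negb_and negbK.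
  by rewrite (rotation_nbr _ _ hr.1) exy.
rewrite e'x; have := hr.1 _ _ z exy; rewrite porbit_fix // => <-.
by case: eqP.
Qed.

Lemma card_isolated_del :
  #|isolated e'| = #|isolated e| + (r u v == v) + (r v u == u).
Proof.
have D (A : {set T}) : #|A| = (u \in A) + ((v \in A) + #|A :\ u :\ v|) :> nat.
  by rewrite (cardsD1 u) (cardsD1 v (_ :\ _)) !inE vu.
rewrite (D (isolated e')) (D (isolated e)).
rewrite (@isolated_del u v) ?(@isolated_del v u) ?eqxx ?orbT //.
have ne w z : e w z -> w \in isolated e = false.
  by move=> ewz; apply/isolatedP => /(_ z); rewrite ewz.
rewrite (ne _ _ euv) (ne _ _ evu) /= !add0n.
suff -> : isolated e' :\ u :\ v = isolated e :\ u :\ v by lia.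
apply/setP=> x; rewrite !in_setD1; do 2![apply: andb_id2l => ?].
apply/isolatedP/isolatedP => h y; have := h y; rewrite e'E.
  by rewrite (negPf (_ : x != u)) // (negPf (_ : x != v)) //= andbT.
by move=> /negPf->.
Qed.

(** The transposition splits the face if both sides of the edge lie on it, and merges two faces
    otherwise. A skip that creates no cycle occurs exactly at an end that becomes isolated, which
    [faces] counts instead. *)
Lemma faces_del :
  faces e' r' + ((u, v) \notin porbit (face_perm e r) (v, u)).*2 = (faces e r).+1.
Proof.
have := facesE e's del_rot_reduced (fun _ _ _ => erefl).
have := facesE es hr (fun _ _ _ => erefl).
rewrite face_perm_del !card_porbits_skip card_isolated_del.
set psi := (_ * _)%g.
have psiu : psi (u, v) = (u, r u v).
  by rewrite permM tpermL face_permE //= evu.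
have psiv : psi (v, u) = (v, r v u).
  by rewrite permM tpermR face_permE //= euv.
rewrite psiu skipE psiv !xpair_eqE (negPf vu) !eqxx /= xpair_eqE eqxx /=.
have := porbits_mul_tperm (face_perm e r) (u, v) (v, u); rewrite /= -/psi.
rewrite xpair_eqE (negPf uv) /=.
have := card_arcs_del.
have := cardsC (arcs e); have := cardsC (arcs e').
case: (r u v == v); case: (r v u == u); rewrite /=; lia.
Qed.

(** If the face of [(u, v)] avoids [(v, u)], the rest of its boundary walk leads from [v] back to
    [u] without the edge. *)
Lemma face_bridge : (u, v) \notin porbit (face_perm e r) (v, u) -> connect e' u v.
Proof.
move=> nf; have cs' := sym_connect_sym e's; rewrite cs'.
set f := face_perm e r in nf.
have it k : k < #|porbit f (u, v)| ->
    connect e' v ((f ^+ k.+1)%g (u, v)).1 /\ (f ^+ k)%g (u, v) \in arcs e.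
  elim: k => [|k IHk] lt_k.
    by rewrite expg0 expg1 perm1 face_permE //= euv inE /= connect0 euv.
  have [con arc] := IHk (ltnW lt_k).
  have arc' : (f ^+ k.+1)%g (u, v) \in arcs e.
    by rewrite expgSr permM face_perm_arc.
  split=> //; apply: connect_trans con _; apply: connect1.
  rewrite (expgSr _ k.+1) permM face_permE //; move: arc'; rewrite inE => ee.
  rewrite ee /= e'E ee /= -!xpair_eqE -surjective_pairing; apply/andP; split.
    (* The arc [(u, v)] does not recur before the cycle closes. *)
    have := uniq_traject_porbit f (u, v).
    case: #|_| lt_k => // n lt_k; rewrite [traject _ _ _]/= => /andP[+ _].
    apply: contraNneq => E; apply/trajectP; exists k; first by [].
    by rewrite -iterSr -permX E.
  apply: contraNneq nf => E; rewrite porbit_sym -E; exact: mem_porbit.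
have n0 : 0 < #|porbit f (u, v)| by rewrite lt0n card_porbit_neq0.
have [] := it (#|porbit f (u, v)|.-1); first by rewrite prednK.
by rewrite prednK // permX iter_porbit.
Qed.

Lemma defect_del :
  euler_count e' + faces e r <= euler_count e + faces e' r'.
Proof.
have := faces_del; have := face_bridge; have := euler_count_del.
case: ((u, v) \in _) => [+ _|+ /(_ isT) c]; last by rewrite c /=; lia.
by case: (connect e' u v); rewrite /=; lia.
Qed.

(** Consecutive neighbours that both survive stay consecutive; this carries pieces of facial walks
    to subgraphs. *)
Lemma del_rot_step x y : e' x y -> e' x (r x y) -> r' x y = r x y.
Proof.
rewrite r'E /del_rot !e'E.
have [->|xu] := eqVneq x u.
  rewrite /= (negPf uv) /= skipE => /and3P[_ + _] /and3P[_ + _].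
  by move=> /negPf-> /negPf->.
have [->|//] := eqVneq x v.
by rewrite /= skipE => /andP[_ /negPf->] /andP[_ /negPf->].
Qed.

End Deletion.


(** * Nonnegative defect, and plane drawings of subgraphs *)

Section Subgraphs.

Variable T : finType.
Implicit Types (e : rel T) (r : T -> {perm T}).

Definition euler e r := #|T| + faces e r = euler_count e.

Lemma eq_arcs e e1 : e =2 e1 -> arcs e = arcs e1.
Proof. by move=> ee; apply/setP => d; rewrite !inE ee. Qed.

Lemma eq_edges e e1 : e =2 e1 -> edges e = edges e1.
Proof. by move=> ee; rewrite /edges (eq_arcs ee). Qed.

Lemma eq_isolated e e1 : e =2 e1 -> isolated e = isolated e1.
Proof.
by move=> ee; apply/setP => x; apply/isolatedP/isolatedP => h y; rewrite ?ee // -ee.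
Qed.

Lemma eq_faces e e1 r : e =2 e1 -> faces e r = faces e1 r.
Proof. by move=> ee; rewrite /faces (eq_arcs ee) (eq_isolated ee). Qed.

Lemma subgraph_rotation e r e1 : simple_graph e -> reduced_rotation e r ->
  simple_graph e1 -> subrel e1 e ->
  exists r1, [/\ reduced_rotation e1 r1,
    forall x y, e1 x y -> e1 x (r x y) -> r1 x y = r x y &
    euler_count e1 + faces e r <= euler_count e + faces e1 r1].
Proof.
elim: {e}_.+1 {-2}e (ltnSn #|arcs e|) r => // n IHn e lt_n r he hr he1 sub.
have [[u v] /andP[/= euv ne1]|none] := pickP (fun d => e d.1 d.2 && ~~ e1 d.1 d.2).
  have [es ei] := he.
  have h := del_edge_simple es ei (fun _ _ => erefl) : simple_graph (del_edge e u v).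
  have hr' : reduced_rotation (del_edge e u v) (del_rot r u v).
    exact: del_rot_reduced ei euv (fun _ _ => erefl) hr (fun _ => erefl).
  have ca : #|arcs e| = #|arcs (del_edge e u v)| + 2.
    exact: card_arcs_del es ei euv (fun _ _ => erefl).
  have le := @defect_del _ e (del_edge e u v) r (del_rot r u v) u v
    es ei euv (fun _ _ => erefl) hr (fun _ => erefl).
  have sub1 : subrel e1 (del_edge e u v).
    move=> x y e1xy; rewrite /del_edge /= sub //=; apply/andP; split;
      apply: contraNN ne1.
      by case/andP=> /eqP<- /eqP<-.
    by case/andP=> /eqP<- /eqP<-; rewrite he1.1.
  have [|r1 [hr1 r1E le1]] := IHn _ _ _ h hr' he1 sub1.
    by move: lt_n; rewrite ca addn2 ltnS => /ltnW.
  exists r1; split=> // [x y xy xry|]; last by move: le le1; lia.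
  have E : del_rot r u v x y = r x y.
    exact: (del_rot_step ei euv (fun _ _ => erefl) (fun _ => erefl)
      (sub1 _ _ xy) (sub1 _ _ xry)).
  by rewrite -E; apply: r1E; rewrite ?E.
have ee : e =2 e1.
  move=> x y; apply/idP/idP; last exact: sub.
  by move=> exy; have := none (x, y); rewrite /= exy /= => /negbFE.
exists r; split=> //.
  by split=> [x y z|x y]; rewrite -!ee; [apply: hr.1|apply: hr.2].
by rewrite /euler_count (eq_edges ee) (eq_faces _ ee) (eq_n_comp (eq_connect ee)).
Qed.

(** Delete all edges: the empty graph has as many faces and components as vertices, so its defect is
    0. *)
Lemma euler_le e r : simple_graph e -> reduced_rotation e r ->
  #|T| + faces e r <= euler_count e.
Proof.
move=> he hr; pose e0 : rel T := fun _ _ => false.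
have [//|//|r0 [_ _]] := subgraph_rotation he hr (e1 := e0).
rewrite {1}/euler_count.
have a0 : arcs e0 = set0 by apply/setP=> d; rewrite !inE.
have -> : n_comp e0 T = #|T|.
  apply: eq_card => x; rewrite !inE andbT; apply/eqP.
  by have /connectP[[|y p]] := connect_root e0 x; rewrite //= => _.
have -> : faces e0 r0 = #|T|.
  rewrite /faces a0 (_ : isolated e0 = setT) ?cardsT; last first.
    by apply/setP=> x; rewrite in_setT; apply/isolatedP.
  by rewrite (_ : fcard _ _ = 0) //; apply: eq_card0 => d; rewrite !inE andbF.
by rewrite /edges a0 imset0 cards0; lia.
Qed.

Lemma subgraph_euler e r e1 : simple_graph e -> reduced_rotation e r ->
  euler e r -> simple_graph e1 -> subrel e1 e ->
  exists r1, [/\ reduced_rotation e1 r1, euler e1 r1 &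
    forall x y, e1 x y -> e1 x (r x y) -> r1 x y = r x y].
Proof.
move=> he hr eu he1 sub; have [r1 [hr1 r1E le]] := subgraph_rotation he hr he1 sub.
exists r1; split=> //; have := euler_le he1 hr1; move: eu; rewrite /euler; lia.
Qed.

End Subgraphs.

(** * Adding an edge to a plane drawing *)

Section Insertion.

Variables (T : finType) (e : rel T) (r : T -> {perm T}) (u v a b : T).

Definition add_edge : rel T :=
  [rel x y | [|| e x y, (x == u) && (y == v) | (x == v) && (y == u)]].

(* v is inserted just before a in the rotation at u, and u just before b in   *)
(* the rotation at v.                                                         *)
Definition add_rot x : {perm T} :=
  if x == u then (r u * tperm v a)%g
  else if x == v then (r v * tperm u b)%g else r x.

Hypotheses (he : simple_graph e) (hr : reduced_rotation e r).
Hypotheses (uv : u != v) (neuv : ~~ e u v).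
Hypothesis (ha : e u a \/ a = v /\ forall w, ~~ e u w).
Hypothesis (hb : e v b \/ b = u /\ forall w, ~~ e v w).

Let es := he.1.
Let ei := he.2.
Let vu : v != u. Proof. by rewrite eq_sym. Qed.
Let nevu : ~~ e v u. Proof. by rewrite es. Qed.

Lemma add_edge_simple : simple_graph add_edge.
Proof.
split=> [x y|x]; rewrite /add_edge /= ?ei /=.
  rewrite es [(x == u) && _]andbC [(x == v) && _]andbC.
  by rewrite [X in _ || X]orbC.
by apply/norP; split; apply: contraNN uv => /andP[/eqP<- /eqP<-].
Qed.

Lemma add_edgeK : e =2 del_edge add_edge u v.
Proof.
move=> x y; rewrite /del_edge /add_edge /=.
have [/andP[/eqP-> /eqP->]|_] := boolP ((x == u) && (y == v)).
  by rewrite (negPf neuv) andbF.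
have [/andP[/eqP-> /eqP->]|_] := boolP ((x == v) && (y == u)).
  by rewrite (negPf nevu) andbF.
by rewrite !orbF !andbT.
Qed.

Lemma add_rotK : r =1 del_rot add_rot u v.
Proof.
have h w z (p : {perm T}) : p w = w -> skip w (p * tperm w z)%g = p.
  by move=> pw; rewrite /skip permM pw tpermL -mulgA tperm2 mulg1.
move=> x; rewrite /del_rot /add_rot !eqxx (negPf vu).
have [->|xu] := eqVneq x u; first by rewrite h // hr.2.
by have [->|xv] := eqVneq x v; rewrite // h // hr.2.
Qed.

Lemma add_rot_reduced : reduced_rotation add_edge add_rot.
Proof.
have h x c w : ~~ e x w -> e x c \/ c = w /\ (forall z, ~~ e x z) ->
    cyclic_on (fun z => e x z || (z == w)) (r x * tperm w c)%g.
  move=> nxw hc; have rw : r x w = w by apply: hr.2.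
  have E : skip w (r x * tperm w c)%g = r x.
    by rewrite /skip permM rw tpermL -mulgA tperm2 mulg1.
  apply: cyclic_on_unskip => //; first by rewrite E; apply: hr.1.
  by rewrite permM rw tpermL.
have h2 x c w y : y != w -> ~~ e x y -> e x c \/ c = w /\ (forall z, ~~ e x z) ->
    (r x * tperm w c)%g y = y.
  move=> yw nxy hc; rewrite permM hr.2 // tpermD // 1?eq_sym //.
  by case: hc => [exc|[-> _]] //; apply: contraNneq nxy => ->.
split=> [x y z|x y]; rewrite /add_edge /add_rot /=.
  have [->|xu] := eqVneq x u; first by rewrite (negPf uv) /= !orbF; apply: (h u a v).
  have [->|xv] := eqVneq x v; first by rewrite /=; apply: (h v b u).
  by rewrite !orbF; apply: hr.1.
have [->|xu] := eqVneq x u.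
  by rewrite (negPf uv) /= !orbF => /norP[? ?]; apply: h2.
have [->|xv] := eqVneq x v; first by rewrite /= => /norP[? ?]; apply: h2.
by rewrite !orbF; apply: hr.2.
Qed.

Let aes := add_edge_simple.1.
Let aei := add_edge_simple.2.
Let auv : add_edge u v. Proof. by rewrite /add_edge /= !eqxx orbT. Qed.

(** By [face_bridge] both sides of the new edge lie on one face, so a face and a component are lost
    while an edge is gained. *)
Lemma add_edge_euler_bridge :
  euler e r -> ~~ connect e u v -> euler add_edge add_rot.
Proof.
rewrite /euler => eu nc.
have := faces_del aes aei auv add_edgeK add_rot_reduced add_rotK.
have := contra (face_bridge aes aei auv add_edgeK add_rot_reduced) nc.
rewrite negbK => -> /=.
by move: eu (euler_count_del aes aei auv add_edgeK); rewrite nc /=; lia.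
Qed.

(** The arcs [(u, a)] and [(v, b)] leave the two corners that receive the new edge; since these are
    on one face, the edge splits it. *)
Lemma add_edge_euler_chord : e u a -> e v b ->
  (v, b) \in porbit (face_perm e r) (u, a) ->
  euler e r -> euler add_edge add_rot.
Proof.
move=> eua evb same; rewrite /euler => eu.
have fd := faces_del aes aei auv add_edgeK add_rot_reduced add_rotK.
have nc := euler_count_del aes aei auv add_edgeK.
set phi := face_perm add_edge add_rot in fd.
pose psi := (tperm (u, v) (v, u) * phi)%g.
have av : add_edge v u by rewrite aes.
have psiu : psi (u, v) = (u, a).
  rewrite permM tpermL face_permE //; last exact: add_rot_reduced.
  by rewrite /= av /face_step /= /add_rot eqxx permM hr.2 // tpermL.
have psiv : psi (v, u) = (v, b).
  rewrite permM tpermR face_permE //; last exact: add_rot_reduced.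
  by rewrite /= auv /face_step /= /add_rot eqxx (negPf vu) permM hr.2 // tpermL.
have psiK : (tperm (u, v) (v, u) * psi)%g = phi by rewrite mulgA tperm2 mul1g.
have same' : (u, v) \in porbit psi (v, u).
  have := face_perm_del aes aei auv add_edgeK add_rotK; rewrite -/phi -/psi => E.
  rewrite porbit_sym in same; move: same; rewrite E => same.
  have := porbit_sub (@skip_mem_porbit _ _ _) same.
  move/(porbit_sub (@skip_mem_porbit _ _ _)); rewrite -psiu -psiv => h.
  apply: porbit_trans (porbit1 psi (v, u)).
  by apply: porbit_trans h; rewrite porbit_sym porbit1.
(* Otherwise multiplying by the transposition would add a cycle in both directions between [phi] and
   [psi]. *)
have nf : (u, v) \notin porbit phi (v, u).
  apply/negP => same2; have := porbits_mul_tperm psi (u, v) (v, u).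
  have := porbits_mul_tperm phi (u, v) (v, u); rewrite /= psiK -/psi same' same2.
  rewrite xpair_eqE (negPf uv) /= double0 !addn0 => -> /eqP.
  by rewrite -addnA -{1}[#|_|]addn0 eqn_add2l.
have := face_bridge aes aei auv add_edgeK add_rot_reduced nf.
by move: eu fd nc; rewrite nf => + + + c; rewrite c /=; lia.
Qed.

End Insertion.


(** * Counting faces by their lengths *)

Section FaceLengths.

Variables (T : finType) (f : T -> T).
Hypothesis f_inj : injective f.

Lemma order_gt n x : (forall i, 0 < i <= n -> iter i f x != x) -> n < fingraph.order f x.
Proof.
move=> h; rewrite ltnNge; apply/negP => le_n.
have := h (fingraph.order f x).
by rewrite fingraph.order_gt0 le_n iter_order // eqxx => /(_ isT).
Qed.

Lemma fcard_order_lt n (A : {pred T}) x : fclosed f A ->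
  (forall y, y \in A -> n <= fingraph.order f y) -> x \in A -> n < fingraph.order f x ->
  fcard f A * n < #|A|.
Proof.
move=> Acl ge_n xA gt_n; have cs := fconnect_sym f_inj.
have rA y : (froot f y \in A) = (y \in A).
  by rewrite -(closed_connect Acl (connect_root _ y)).
rewrite -sum1_card (partition_big (froot f) [predI froots f & A]) /=; last first.
  by move=> y yA; rewrite !inE rA (roots_root cs).
have fiber y : froots f y && (y \in A) ->
    \sum_(i in A | froot f i == y) 1 = fingraph.order f y.
  move=> /andP[/eqP ry yA]; rewrite sum1_card; apply: eq_card => z.
  rewrite unfold_in -{1}ry (root_connect cs) cs; apply: andb_idl => yz.
  by have := closed_connect Acl yz; rewrite yA => <-.
rewrite (eq_bigr _ fiber) -sum_nat_const.
have rx : froots f (froot f x) && (froot f x \in A) by rewrite roots_root // rA.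
rewrite (bigD1 (froot f x)) //= [X in _ < X](bigD1 (froot f x)) //=.
rewrite -addSn leq_add //.
  by rewrite /fingraph.order -(eq_card (same_connect cs (connect_root _ x))).
by apply: leq_sum => y /andP[/andP[_ yA] _]; apply: ge_n.
Qed.

End FaceLengths.

Section FaceStep.

Variables (T : finType) (e : rel T) (r : T -> {perm T}).

Lemma face_step_inj : injective (face_step r).
Proof. by move=> [x y] [x' y'] [-> /perm_inj->]. Qed.

Lemma arcs_fclosed :
  symmetric e -> rotation_system e r -> fclosed (face_step r) (arcs e).
Proof.
by move=> es hr [x y] _ /eqP<-; rewrite !inE /= rotation_nbr // es.
Qed.

End FaceStep.

(** * Plane drawings of the complete graph on four vertices *)

Section CompleteGraph.

Variables (T : finType) (K : {set T}) (r : T -> {perm T}) (u v w z : T).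

Definition complete_on : rel T := [rel x y | [&& x != y, x \in K & y \in K]].

Hypotheses (K4 : #|K| = 4) (hr : reduced_rotation complete_on r).
Hypotheses (uv : complete_on u v) (rvu : r v u = w) (rwv : r w v = z) (zu : z != u).

Lemma complete_on_simple : simple_graph complete_on.
Proof.
split=> [x y|x]; rewrite /complete_on /= ?eqxx // eq_sym.
by rewrite [(x \in K) && _]andbC.
Qed.

Let es := complete_on_simple.1.

Lemma deg_complete x : deg complete_on x = if x \in K then 3 else 0.
Proof.
case: ifP => xK; last first.
  by apply/eqP; rewrite cards_eq0; apply/eqP/setP=> y; rewrite !inE /complete_on /= xK andbF.
rewrite /deg (_ : [set _ | _] = K :\ x); last first.
  by apply/setP=> y; rewrite !inE /complete_on /= xK eq_sym.
by have := cardsD1 x K; rewrite xK K4 add1n => -[].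
Qed.

Lemma card_arcs_complete : #|arcs complete_on| = 12.
Proof.
rewrite card_arcs_deg (eq_bigr (fun x => if x \in K then 3 else 0)); last first.
  by move=> x _; apply: deg_complete.
by rewrite -big_mkcond sum_nat_const K4.
Qed.

Lemma isolated_complete : isolated complete_on = ~: K.
Proof. by apply/setP=> x; rewrite inE deg_complete !inE; case: (x \in K). Qed.

Lemma n_comp_complete : #|~: K| < n_comp complete_on T.
Proof.
have iso x y : x \notin K -> connect complete_on x y -> x = y.
  move=> xK /connectP[[|t p] //=]; rewrite /complete_on /= (negPf xK) andbF.
  by [].
have uK : u \in K by case/and3P: uv.
have cs := sym_connect_sym es.
have ruK : root complete_on u \in K.
  apply: contraTT uK => ruK; rewrite -(iso _ u ruK) //.
  by rewrite cs connect_root.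
have -> : #|~: K|.+1 = #|root complete_on u |: ~: K|.
  by rewrite cardsU1 inE ruK.
apply: subset_leq_card; apply/subsetP => x; rewrite !inE andbT => /orP[/eqP->|xK].
  exact: roots_root.
by apply/eqP; apply/esym/iso => //; apply: connect_root.
Qed.

(* A tetrahedron drawn in the plane has four faces, all of them triangles. *)
Lemma not_euler_complete : ~ euler complete_on r.
Proof.
have [rs _] := hr; have cl := arcs_fclosed es rs.
have inj := @face_step_inj T r.
have len2 x y : complete_on x y -> r y x != x.
  move=> exy; apply/negP => /eqP ryx.
  have N t : complete_on y t -> t = x.
    by move=> eyt; apply/eqP; rewrite -(porbit_fix _ ryx) rs // es.
  have : deg complete_on y <= #|[set x]|.
    by apply/subset_leq_card/subsetP => t; rewrite !inE => /N ->.
  by rewrite deg_complete cards1; case/and3P: exy => _ _ ->.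
have len3 d : d \in arcs complete_on -> 3 <= fingraph.order (face_step r) d.
  case: d => x y; rewrite inE => exy; apply: order_gt => // -[|[|[|i]]] //= _.
    by rewrite xpair_eqE negb_and; case/and3P: exy; rewrite eq_sym => ->.
  by rewrite xpair_eqE negb_and len2.
have uvA : (u, v) \in arcs complete_on by rewrite inE.
have len4 : 3 < fingraph.order (face_step r) (u, v).
  apply: order_gt => // -[|[|[|[|i]]]] //= _.
  - by rewrite xpair_eqE negb_and; case/and3P: uv; rewrite eq_sym => ->.
  - by rewrite xpair_eqE negb_and len2.
  - by rewrite xpair_eqE /face_step /= rvu rwv (negPf zu).
have ltF := fcard_order_lt inj cl len3 uvA len4.
have E := card_arcs complete_on_simple; rewrite card_arcs_complete in ltF E.
have CK := cardsC K; rewrite K4 in CK.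
rewrite /euler /euler_count /faces isolated_complete => eu.
(* With 6 edges and at least [k + 1] components Euler's formula demands F >= 4, but a face longer
   than 3 leaves 3F < 12. *)
have arith (t k c m F : nat) :
    4 + k = t -> k < c -> 12 = 2 * m -> F * 3 < 12 -> t + (F + k) <> m + 2 * c.
  by lia.
exact: (arith _ _ _ _ _ CK n_comp_complete E ltF eu).
Qed.

End CompleteGraph.


(** * Faces and degrees in an edge-maximal plane graph *)

Section Triangulations.

Variables (T : finType) (e : rel T) (r : T -> {perm T}).
Hypotheses (he : simple_graph e) (hr : reduced_rotation e r) (eu : euler e r).
Hypothesis hmax : forall u v r', u != v -> ~~ e u v ->
  reduced_rotation (add_edge e u v) r' -> ~ euler (add_edge e u v) r'.
Hypothesis hcard : 5 <= #|T|.

Let es := he.1.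
Let ei := he.2.

Lemma adj_neq x y : e x y -> x != y.
Proof. by apply: contraTneq => ->; rewrite ei. Qed.

Lemma triangulation_connected u v : connect e u v.
Proof.
apply: contraT => nc.
have uv : u != v by apply: contraNneq nc => ->; apply: connect0.
have nuv : ~~ e u v by apply: contraNN nc; apply: connect1.
have corner x w : exists c, e x c \/ c = w /\ forall y, ~~ e x y.
  have [c exc|none] := pickP (e x); first by exists c; left.
  by exists w; right; split=> // y; rewrite none.
have [a ha] := corner u v; have [b hb] := corner v u.
by case: (hmax uv nuv (add_rot_reduced he hr uv nuv ha hb)); apply: add_edge_euler_bridge.
Qed.

Lemma cofacial_adj u a v b : e u a -> e v b ->
  (v, b) \in porbit (face_perm e r) (u, a) -> u != v -> e u v.
Proof.
move=> eua evb same uv; apply: contraT => nuv.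
have ha : e u a \/ a = v /\ forall w, ~~ e u w by left.
have hb : e v b \/ b = u /\ forall w, ~~ e v w by left.
by case: (hmax uv nuv (add_rot_reduced he hr uv nuv ha hb)); apply: add_edge_euler_chord.
Qed.

(** By connectedness such a list contains all vertices; small configurations are refuted by
    exhibiting a short closed list. *)
Lemma closed_seq_ge5 (s : seq T) x :
  x \in s -> (forall y z, y \in s -> e y z -> z \in s) -> 5 <= size s.
Proof.
move=> xs cl; apply: leq_trans hcard (leq_trans _ (card_size s)).
apply: subset_leq_card; apply/subsetP=> y _.
have Acl : closed e (mem s).
  by apply: (intro_closed (sym_connect_sym es)) => z t ezt zs; apply: cl ezt.
by rewrite -(closed_connect Acl (triangulation_connected x y)).
Qed.

Lemma rot_adj v u : e v u -> e v (r v u).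
Proof. by rewrite (rotation_nbr _ _ hr.1). Qed.

Lemma nbr_ind v (Q : T -> Prop) u w :
  (forall z, Q z -> Q (r v z)) -> Q u -> e v u -> e v w -> Q w.
Proof.
by move=> QS Qu evu; rewrite -(hr.1 _ _ _ evu) => wu; apply: porbit_ind wu.
Qed.

Lemma face_perm_rot u v : e u v -> face_perm e r (u, v) = (v, r v u).
Proof. by move=> euv; rewrite face_permE //= euv. Qed.

(** A leaf [v] shares a face with the next neighbour of [u], so it would be adjacent to that too. *)
Lemma rot_neq v u : e v u -> r v u != u.
Proof.
move=> evu; have euv : e u v by rewrite es.
apply/negP => /eqP rvu.
have Nv w : e v w -> w = u by apply: (nbr_ind (Q := fun w => w = u)) evu => // z ->.
have [ruv|xv] := eqVneq (r u v) v.
  have Nu w : e u w -> w = v by apply: (nbr_ind (Q := fun w => w = v)) euv => // z ->.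
  suff: 5 <= size [:: u; v] by [].
  apply: (@closed_seq_ge5 _ u) => [|y z]; rewrite !inE ?eqxx // => /orP[]/eqP->.
    by move/Nu=> ->; rewrite eqxx orbT.
  by move/Nv=> ->; rewrite eqxx.
have eux := rot_adj euv.
have : e v (r u v).
  apply: (@cofacial_adj _ u _ (r (r u v) u)) => //; last by rewrite eq_sym.
    by apply: rot_adj; rewrite es.
  rewrite -(face_perm_rot eux) -(face_perm_rot evu); do 2![apply: porbitS].
  exact: porbit_id.
by move/Nv => E; move: eux; rewrite E ei.
Qed.

Lemma rot_nbr_adj v u : e v u -> e u (r v u).
Proof.
move=> evu; have euv : e u v by rewrite es.
have evw := rot_adj evu.
apply: (@cofacial_adj _ v _ (r (r v u) v)) => //; last by rewrite eq_sym rot_neq.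
  by apply: rot_adj; rewrite es.
rewrite -(face_perm_rot evw) -(face_perm_rot euv); do 2![apply: porbitS].
exact: porbit_id.
Qed.

(** Otherwise [u], [v], [w], [z] are distinct vertices of one face, so pairwise adjacent. The
    drawing induced on them keeps the turns at [v] and [w], hence has a non-triangular face, against
    [not_euler_complete]. *)
Lemma face_triangle v u : e v u -> r (r v u) v = u.
Proof.
move=> evu; have euv : e u v by rewrite es.
set w := r v u; have evw : e v w := rot_adj evu.
have ewv : e w v by rewrite es.
set z := r w v; have ewz : e w z := rot_adj ewv.
apply/eqP/contraT => zu.
have euw : e u w := rot_nbr_adj evu.
have evz : e v z := rot_nbr_adj ewv.
have euz : e u z.
  apply: (@cofacial_adj _ v _ (r z w)) => //; last by rewrite eq_sym.
    by apply: rot_adj; rewrite es.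
  rewrite -(face_perm_rot ewz) -(face_perm_rot evw) -(face_perm_rot euv).
  by do 3![apply: porbitS]; apply: porbit_id.
pose K := [set u; v; w; z].
have K4 : #|K| = 4.
  rewrite /K -!setUA !cardsU1 !inE !cards1.
  by rewrite (negPf (adj_neq euv)) (negPf (adj_neq euw)) (negPf (adj_neq euz))
    (negPf (adj_neq evw)) (negPf (adj_neq evz)) (negPf (adj_neq ewz)).
have eK : subrel (complete_on K) e.
  move=> x y /and3P[xy]; rewrite !inE -!orbA.
  by case/or4P=> /eqP E; subst x; case/or4P=> /eqP E; subst y;
    rewrite ?eqxx // in xy *; rewrite // es.
have inK x y : x \in K -> y \in K -> e x y -> complete_on K x y.
  by move=> xK yK exy; rewrite /complete_on /= adj_neq ?xK.
have uK : u \in K by rewrite !inE eqxx.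
have vK : v \in K by rewrite !inE eqxx !orbT.
have wK : w \in K by rewrite !inE eqxx !orbT.
have zK : z \in K by rewrite !inE eqxx !orbT.
have [r1 [hr1 eu1 r1E]] := subgraph_euler he hr eu (complete_on_simple K) eK.
have r1vu : r1 v u = w by apply: r1E; apply: inK.
have r1wv : r1 w v = z by apply: r1E; apply: inK.
have uv1 : complete_on K u v by apply: inK.
by case: (not_euler_complete K4 hr1 uv1 r1vu r1wv zu eu1).
Qed.

(** At a vertex of degree 2 the triangular faces force the same at both neighbours, and the graph is
    a triangle. *)
Lemma rot2_neq v u : e v u -> r v (r v u) != u.
Proof.
move=> evu; apply/negP => /eqP rvw.
set w := r v u in rvw; have evw : e v w := rot_adj evu.
have euv : e u v by rewrite es.
have ewv : e w v by rewrite es.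
have rwv : r w v = u by apply: face_triangle.
have ruw : r u w = v by rewrite -rwv face_triangle.
have ruv : r u v = w by rewrite -[in LHS]rvw face_triangle.
have rwu : r w u = v by rewrite -ruv face_triangle.
have N x a b : r x a = b -> r x b = a -> e x a -> forall y, e x y -> (y == a) || (y == b).
  move=> ra rb exa y; apply: (nbr_ind (Q := fun y => (y == a) || (y == b))) exa.
    by move=> t /orP[]/eqP->; rewrite ?ra ?rb eqxx ?orbT.
  by rewrite eqxx.
suff: 5 <= size [:: u; v; w] by [].
apply: (@closed_seq_ge5 _ u) => [|y z]; rewrite !inE ?eqxx //.
case/or3P=> /eqP->.
- by move/(N _ _ _ ruv ruw euv) => /orP[]->; rewrite ?orbT.
- by move/(N _ _ _ (erefl : r v u = w) rvw evu) => /orP[]->; rewrite ?orbT.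
- by move/(N _ _ _ rwv rwu ewv) => /orP[]->; rewrite ?orbT.
Qed.

Lemma ex_nbr v : exists u, e v u.
Proof.
have [u evu|none] := pickP (e v); first by exists u.
suff: 5 <= size [:: v] by [].
by apply: (@closed_seq_ge5 _ v) => [|y z]; rewrite inE // => /eqP->; rewrite none.
Qed.

(** Triangular faces give 3F = 2E; all degrees at least 6 would give 6V <= 2E, so V + F <= E. *)
Lemma ex_deg_lt6 : exists v, deg e v < 6.
Proof.
apply/existsP; apply: contraT; rewrite negb_exists => /forallP h.
have [x0 _] : exists x : T, x \in T by apply/card_gt0P; apply: leq_trans hcard.
have cl := arcs_fclosed es hr.1.
have len3 : arcs e \subset order_set (face_step r) 3.
  apply/subsetP => -[x y]; rewrite !inE /= => exy; have eyx : e y x by rewrite es.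
  rewrite eqn_leq; apply/andP; split; last first.
    apply: (order_gt (@face_step_inj T r)) => -[|[|[|i]]] //= _.
      by rewrite xpair_eqE negb_and adj_neq.
    by rewrite xpair_eqE negb_and rot_neq.
  have cyc : fcycle (face_step r) [:: (x, y); (y, r y x); (r y x, x)].
    have ewy : e (r y x) y by rewrite es rot_adj.
    have := face_triangle ewy; rewrite (face_triangle eyx) => rxw.
    by rewrite /= /face_step /= (face_triangle eyx) rxw !eqxx.
  by apply: (order_le_cycle cyc); rewrite inE eqxx.
have F3 := fcard_order_set (@face_step_inj T r) len3 cl.
have iso0 : isolated e = set0.
  apply/setP=> x; rewrite in_set0; have [y exy] := ex_nbr x.
  by apply/isolatedP => /(_ y); rewrite exy.
have c1 : n_comp e T = 1.
  rewrite -(n_comp_connect (sym_connect_sym es) x0); apply: eq_n_comp_r => x.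
  by rewrite [RHS]triangulation_connected.
have D : 6 * #|T| <= #|arcs e|.
  rewrite card_arcs_deg mulnC -sum_nat_const; apply: leq_sum => x _.
  by rewrite leqNgt h.
have A := card_arcs he.
move: eu; rewrite /euler /euler_count /faces iso0 cards0 c1 addn0.
have arith (t F m k : nat) :
  F * 3 = k -> 6 * t <= k -> k = 2 * m -> t + F <> m + 2 * 1 by lia.
by move=> E; case: (arith _ _ _ _ F3 D A E).
Qed.

(** The triangle bounds a face, in one of the two orientations. *)
Definition facial a b c := e a b && ((r a b == c) || (r a c == b)).

Lemma facialCr a b c : facial a b c -> facial a c b.
Proof.
case/andP=> eab abc; rewrite /facial orbC abc andbT.
by case/orP: abc => /eqP E; rewrite -?E ?rot_adj // -(rotation_nbr _ _ hr.1) E.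
Qed.

Lemma facialCl a b c : facial a b c -> facial b a c.
Proof.
case/andP=> eab abc; rewrite /facial es eab /=.
case/orP: abc => /eqP E.
  have eac : e c a by rewrite es -E rot_adj.
  have rca : r c a = b by rewrite -E face_triangle.
  by rewrite -[in X in _ || X]rca face_triangle // eqxx orbT.
have eac : e a c by rewrite -(rotation_nbr _ _ hr.1) E.
by rewrite -[in X in X || _]E face_triangle // eqxx.
Qed.

Lemma facial_adj a b c : facial a b c -> [/\ e a b, e a c & e b c].
Proof.
move=> abc; split; first by case/andP: abc.
  by case/andP: (facialCr abc).
by case/andP: (facialCr (facialCl abc)).
Qed.

Lemma two_apexes a b : e a b -> exists x y,
  [/\ x != y, facial a b x, facial a b y & forall z, facial a b z -> z = x \/ z = y].
Proof.
move=> eab; pose y := ((r a)^-1)%g b.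
have ry : r a y = b by rewrite permKV.
have eay : e a y by rewrite -(rotation_nbr _ _ hr.1) ry.
exists (r a b), y; split; rewrite /facial ?eab ?ry ?eqxx ?orbT //.
  by rewrite -{1}ry rot2_neq.
move=> z /= /orP[]/eqP E; [by left|right].
by apply: (@perm_inj _ (r a)); rewrite ry.
Qed.

Lemma facial_nbrs x a b c : uniq [:: a; b; c] ->
  facial x a b -> facial x b c -> facial x a c ->
  forall y, e x y -> y \in [:: a; b; c].
Proof.
rewrite /= !inE negb_or !andbT => /andP[/andP[ab ac] bc].
move=> /andP[exa hab] /andP[_ hbc] /andP[_ hac] y exy.
have inj p q : p != q -> r x p = r x q -> False by move=> /eqP pq /perm_inj.
have clo : forall z, z \in [:: a; b; c] -> r x z \in [:: a; b; c].
  case/orP: hab => /eqP rab.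
    have rbc : r x b = c by case/orP: hbc => /eqP // E; case: (inj a c ac); rewrite rab.
    have rca : r x c = a by case/orP: hac => /eqP // E; case/eqP: bc; rewrite -rab.
    by move=> z; rewrite !inE => /or3P[]/eqP->; rewrite ?rab ?rbc ?rca eqxx ?orbT.
  have rcb : r x c = b by case/orP: hbc => /eqP // E; case/eqP: ac; rewrite -rab.
  have rac : r x a = c.
    by case/orP: hac => /eqP // E; case/eqP: ab; rewrite -rcb E.
  by move=> z; rewrite !inE => /or3P[]/eqP->; rewrite ?rab ?rcb ?rac eqxx ?orbT.
by apply: (nbr_ind (Q := fun y => y \in [:: a; b; c]) clo _ exa exy); rewrite inE eqxx.
Qed.

Lemma not_tetrahedron a b c d : uniq [:: a; b; c; d] ->
  facial a b c -> facial a b d -> facial a c d -> facial b c d -> False.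
Proof.
move=> U abc abd acd bcd.
move: U; rewrite /= !inE !negb_or !andbT.
case/and3P=> [/and3P[ab ac ad] /andP[bc bd] cd].
have U3 (p q s : T) : p != q -> p != s -> q != s -> uniq [:: p; q; s].
  by rewrite /= !inE negb_or => -> -> ->.
suff: 5 <= size [:: a; b; c; d] by [].
apply: (@closed_seq_ge5 _ a) => [|x y]; rewrite inE ?eqxx //= !inE => xS exy.
suff: y \in [:: a; b; c; d] by rewrite !inE.
case/or4P: xS exy => /eqP->.
- move/(facial_nbrs (U3 b c d bc bd cd) abc acd abd).
  by rewrite !inE => /or3P[]->; rewrite ?orbT.
- move/(facial_nbrs (U3 a c d ac ad cd) (facialCl abc) bcd (facialCl abd)).
  by rewrite !inE => /or3P[]->; rewrite ?orbT.
- move/(facial_nbrs (U3 a b d ab ad bd) (facialCl (facialCr abc))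
    (facialCl bcd) (facialCl acd)).
  by rewrite !inE => /or3P[]->; rewrite ?orbT.
- move/(facial_nbrs (U3 a b c ab ac bc) (facialCl (facialCr abd))
    (facialCl (facialCr bcd)) (facialCl (facialCr acd))).
  by rewrite !inE => /or3P[]->; rewrite ?orbT.
Qed.

(** * Consequences of a proper colouring without rainbow 4-cycles *)

Variables (C : eqType) (col : {set T} -> C).
Hypothesis hproper : proper_edge_coloring e col.
Hypothesis hrainbow : ~ has_rainbow_C4 e col.

Let c x y := col [set x; y].

Lemma colorC x y : c x y = c y x.
Proof. by rewrite /c setUC. Qed.

Lemma color_adj a x y : e a x -> e a y -> c a x = c a y -> x = y.
Proof.
move=> eax eay E; apply/eqP; apply: contraT => xy.
have ed p q : e p q -> [set p; q] \in edges e.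
  by move=> epq; apply/imsetP; exists (p, q); rewrite ?inE.
have : col [set a; x] != col [set a; y].
  apply: hproper; rewrite ?ed //; last by apply/set0Pn; exists a; rewrite !inE eqxx.
  apply: contraNneq xy => /setP/(_ x); rewrite !inE eqxx orbT => /esym/orP[]// /eqP E'.
  by rewrite E' ei in eax.
by rewrite -/(c a x) E eqxx.
Qed.

Lemma C4_opposite x y z t : e x y -> e y z -> e z t -> e t x -> x != z -> y != t ->
  c x y = c z t \/ c y z = c t x.
Proof.
move=> exy eyz ezt etx xz yt.
have [|ne1] := eqVneq (c x y) (c z t); first by left.
have [|ne2] := eqVneq (c y z) (c t x); first by right.
case: hrainbow; exists x, y, z, t; split; first split.
- rewrite /= !inE !negb_or xz yt (adj_neq exy) (adj_neq eyz) (adj_neq ezt).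
  by rewrite eq_sym (adj_neq etx).
- by rewrite exy eyz ezt etx.
have n1 : c x y != c y z.
  by apply: contraNneq xz; rewrite colorC => /color_adj -> //; rewrite es.
have n2 : c y z != c z t.
  by apply: contraNneq yt; rewrite colorC => /color_adj -> //; rewrite es.
have n3 : c z t != c t x.
  by apply: contraNneq xz; rewrite colorC => /color_adj -> //; rewrite es.
have n4 : c x y != c t x.
  by apply: contraNneq yt; rewrite [c t x]colorC => /color_adj -> //; rewrite es.
by rewrite /= !inE !negb_or ne1 ne2 n1 n2 n3 n4.
Qed.

(** For [x] other than [q], either outcome for the 4-cycle [q a x b] repeats at [a] or [b] the
    colour of the edge to [p]. *)
Lemma bicolored_K4_apex a b p q x :
  e a b -> e a p -> e a q -> e b p -> e b q -> c a q = c b p -> c b q = c a p ->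
  e a x -> e b x -> x = p \/ x = q.
Proof.
move=> eab eap eaq ebp ebq M1 M2 eax ebx.
have [|xq] := eqVneq x q; first by right.
left; have [||||||E|E] := @C4_opposite q a x b; rewrite ?[e q a]es ?[e x b]es //.
- by rewrite eq_sym.
- exact: adj_neq eab.
- by apply: (color_adj ebx ebp); rewrite -M1 [c a q]colorC E colorC.
- by apply: (color_adj eax eap); rewrite -M2 E.
Qed.

Lemma apexes_eq a b p q : e a b -> p != q ->
  (forall x, e a x -> e b x -> x = p \/ x = q) -> facial a b p /\ facial a b q.
Proof.
move=> eab pq h; have [x [y [xy fx fy _]]] := two_apexes eab.
have [_ eax ebx] := facial_adj fx; have [_ eay eby] := facial_adj fy.
have := h x eax ebx; have := h y eay eby.
by case=> ?; case=> ?; subst x y; rewrite ?eqxx in xy.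
Qed.

Lemma no_bicolored_K4 a b p q :
  e a b -> e a p -> e a q -> e b p -> e b q -> e p q ->
  c a q = c b p -> c b q = c a p -> False.
Proof.
move=> eab eap eaq ebp ebq epq M1 M2.
have [abp abq] : facial a b p /\ facial a b q.
  by apply: apexes_eq => // [|x]; [apply: adj_neq epq|apply: bicolored_K4_apex].
have [pqa pqb] : facial p q a /\ facial p q b.
  have [epa eqa] : e p a /\ e q a by split; rewrite es.
  have [epb eqb] : e p b /\ e q b by split; rewrite es.
  apply: apexes_eq => // [|x]; first exact: adj_neq eab.
  by apply: bicolored_K4_apex => //; rewrite colorC -?M1 ?M2 colorC.
apply: (@not_tetrahedron a b p q) => //.
- by rewrite /= !inE !negb_or !adj_neq.
- exact: facialCl (facialCr pqa).
- exact: facialCl (facialCr pqb).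
Qed.

(** Each of the three 4-cycles is a union of two perfect matchings, one of them monochromatic; so at
    least two of the three matchings are. *)
Lemma no_K4 x y z t : e x y -> e x z -> e x t -> e y z -> e y t -> e z t -> False.
Proof.
move=> exy exz ext eyz eyt ezt.
have [eyx ezx etx] : [/\ e y x, e z x & e t x] by split; rewrite es.
have [ezy ety etz] : [/\ e z y, e t y & e t z] by split; rewrite es.
have N := adj_neq.
have := C4_opposite exy eyz ezt etx (N _ _ exz) (N _ _ eyt).
have := C4_opposite exy eyt etz ezx (N _ _ ext) (N _ _ eyz).
have := C4_opposite exz ezy eyt etx (N _ _ exy) (N _ _ ezt).
rewrite [c t x]colorC [c t z]colorC [c z x]colorC [c z y]colorC.
have H1 : c x t = c y z -> c y t = c x z -> False :=
  no_bicolored_K4 exy exz ext eyz eyt ezt.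
have H2 : c x t = c z y -> c z t = c x y -> False :=
  no_bicolored_K4 exz exy ext ezy ezt eyt.
have H3 : c x z = c t y -> c t z = c x y -> False :=
  no_bicolored_K4 ext exy exz ety etz eyz.
move: H1 H2 H3; rewrite [c z y]colorC [c t y]colorC [c t z]colorC.
by move=> H1 H2 H3 [] ? [] ? [] ?; auto.
Qed.

Lemma rot3_neq v u : e v u -> r v (r v (r v u)) != u.
Proof.
move=> evu; apply/negP => /eqP E.
set u1 := r v u in E; set u2 := r v u1 in E.
have ev1 : e v u1 := rot_adj evu; have ev2 : e v u2 := rot_adj ev1.
have e20 : e u2 u by rewrite -E rot_nbr_adj.
by apply: (@no_K4 v u u1 u2); rewrite ?rot_nbr_adj // es.
Qed.

(** Each 4-cycle through the hub gives a rim edge the colour of a spoke. Spoke colours being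
    distinct, one choice forces the rest around the wheel; then all rim colours differ and the rim
    is rainbow. *)
Lemma rot4_neq v u : e v u -> r v (r v (r v (r v u))) != u.
Proof.
move=> evu; apply/negP => /eqP E.
set u1 := r v u in E; set u2 := r v u1 in E; set u3 := r v u2 in E.
have ev1 : e v u1 := rot_adj evu; have ev2 : e v u2 := rot_adj ev1.
have ev3 : e v u3 := rot_adj ev2.
have e01 : e u u1 := rot_nbr_adj evu; have e12 : e u1 u2 := rot_nbr_adj ev1.
have e23 : e u2 u3 := rot_nbr_adj ev2.
have e30 : e u3 u by rewrite -E rot_nbr_adj.
have n02 : u2 != u := rot2_neq evu; have n13 : u3 != u1 := rot2_neq ev1.
have e1v : e u1 v by rewrite es.
have e2v : e u2 v by rewrite es.
have e3v : e u3 v by rewrite es.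
have n20 : u != u2 by rewrite eq_sym.
have n31 : u1 != u3 by rewrite eq_sym.
have N := adj_neq.
have h0 := C4_opposite evu e01 e12 e2v (N _ _ ev1) n20.
have h1 := C4_opposite ev1 e12 e23 e3v (N _ _ ev2) n31.
have h2 : c v u2 = c u3 u \/ c u2 u3 = c u v.
  by apply: C4_opposite => //; rewrite ?N // es.
have h3 : c v u3 = c u u1 \/ c u3 u = c u1 v.
  by apply: C4_opposite => //; rewrite ?N // es.
have h4 := C4_opposite e01 e12 e23 e30 n20 n31.
move: h0 h1 h2 h3; rewrite ![c _ v]colorC => h0 h1 h2 h3.
have d p q : e v p -> e v q -> p != q -> c v p <> c v q.
  by move=> evp evq /eqP pq /(color_adj evp evq).
have d01 := d _ _ evu ev1 (N _ _ e01); have d02 := d _ _ evu ev2 n20.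
have d12 := d _ _ ev1 ev2 (N _ _ e12); have d13 := d _ _ ev1 ev3 n31.
have d23 := d _ _ ev2 ev3 (N _ _ e23); have d30 := d _ _ ev3 evu (N _ _ e30).
by case: h0 => ?; case: h1 => ?; case: h2 => ?; case: h3 => ?; case: h4 => ?; congruence.
Qed.

Lemma deg_ge5 v : 5 <= deg e v.
Proof.
have [u evu] := ex_nbr v.
have ev1 := rot_adj evu; have ev2 := rot_adj ev1; have ev3 := rot_adj ev2.
have ev4 := rot_adj ev3.
set u1 := r v u in ev1 ev2 ev3 ev4; set u2 := r v u1 in ev2 ev3 ev4.
set u3 := r v u2 in ev3 ev4; set u4 := r v u3 in ev4.
have U : uniq [:: u4; u3; u2; u1; u].
  rewrite /= !inE !negb_or.
  by rewrite ?rot_neq ?rot2_neq ?rot3_neq ?rot4_neq.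
rewrite -[5]/(size [:: u4; u3; u2; u1; u]) -(card_uniqP U).
apply: subset_leq_card; apply/subsetP => x; rewrite !inE.
by case/or4P=> [/eqP->|/eqP->|/eqP->|/orP[]/eqP->].
Qed.

(** Each face at [ab] has an apex [z] forming a 4-cycle [a z b p]. The outcome [c a z = c b p] can
    hold for only one of the two apexes. *)
Lemma nonfacial_apex a b p : e a b -> e a p -> e b p -> ~~ facial a b p ->
  exists z, [/\ e a z, e b z & c b z = c a p].
Proof.
move=> eab eap ebp nf; have [x [y [xy fx fy _]]] := two_apexes eab.
have h z : facial a b z -> c a z = c b p \/ c b z = c a p.
  move=> fz; have [_ eaz ebz] := facial_adj fz.
  have zp : z != p by apply: contraNneq nf => <-.
  have [||||||E|E] := @C4_opposite a z b p; rewrite ?(adj_neq eab) // 1?es //.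
    by left.
  by right; rewrite colorC E colorC.
have [_ eax ebx] := facial_adj fx; have [_ eay eby] := facial_adj fy.
case: (h x fx) => Ex; last by exists x.
case: (h y fy) => Ey; last by exists y.
by case/eqP: xy; apply: (color_adj eax eay); rewrite Ex Ey.
Qed.

(** The apexes obtained over [ab] and over [pb] are joined to [b] by edges of the same colour, so
    they coincide and complete a K4. *)
Lemma triangle_facial a b p : e a b -> e a p -> e b p -> facial a b p.
Proof.
move=> eab eap ebp; apply: contraT => nf.
have nf' : ~~ facial p b a.
  by apply: contraNN nf => /facialCr/facialCl/facialCr.
have [epb epa eba] : [/\ e p b, e p a & e b a] by split; rewrite es.
have [x [eax ebx Ex]] := nonfacial_apex eab eap ebp nf.
have [y [epy eby Ey]] := nonfacial_apex epb epa eba nf'.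
have xy : x = y by apply: (color_adj ebx eby); rewrite Ex Ey colorC.
by subst y; case: (no_K4 eab eap eax ebp ebx epy).
Qed.

(** * Separators of at most three vertices *)

Lemma small_set_not_separating (S : {set T}) u v :
  #|S| <= 3 -> u \notin S -> v \notin S -> connect (remove_vertices e S) u v.
Proof.
have [n] := ubnP #|S|; elim: n S => // n IHn S lt_n le3 uS vS.
apply: contraT => nc.
have Dsym (S' : {set T}) : connect_sym (remove_vertices e S').
  by apply: sym_connect_sym => x y; rewrite /remove_vertices /= es andbCA.
set D := remove_vertices e S in nc.
have DE x y : x \notin S -> y \notin S -> e x y -> D x y.
  by move=> xS yS exy; rewrite /D /remove_vertices /= xS yS exy.
pose A x := connect D u x.
have AS x : A x -> x \notin S.
  have cl : closed D [predC S].
    by move=> y z; rewrite /D /remove_vertices /= !inE => /and3P[-> -> _].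
  by move=> /(closed_connect cl); rewrite !inE uS => <-.
have AD x y : A x -> y \notin S -> e x y -> A y.
  move=> Ax yS exy; apply: (connect_trans (Ax : connect D u x)); apply: connect1.
  by apply: DE yS exy; apply: AS Ax.
(* By induction [S :\ s] does not separate; if [s] had no neighbour on one side, that side would
   remain closed once [s] is restored. *)
have sides s : s \in S -> (exists2 x, e s x & A x) /\
    (exists y, [/\ e s y, y \notin S & ~~ A y]).
  move=> sS; have con : connect (remove_vertices e (S :\ s)) u v.
    apply: IHn; rewrite ?inE ?negb_and ?uS ?vS ?orbT //.
      by move: lt_n; rewrite (cardsD1 s) sS.
    by move: le3; rewrite (cardsD1 s) sS => /ltnW.
  have notS y : y \notin S :\ s -> y != s -> y \notin S.
    by rewrite !inE negb_and negbK => /orP[/eqP->|]; rewrite ?eqxx.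
  split.
    have [x /andP[esx Ax]|none] := pickP (fun x => e s x && A x); first by exists x.
    have cl : closed (remove_vertices e (S :\ s)) A.
      apply: (intro_closed (Dsym _)) => x y /and3P[xS yS exy] Ax.
      apply: (AD x) => //; apply: notS => //; apply: contraFneq (none x) => <-.
      by rewrite es exy.
    by move: nc; rewrite -/(A v) -[A v](closed_connect cl con) [_ \in _]connect0.
  have [y /and3P[esy yS Ay]|none] := pickP (fun y => [&& e s y, y \notin S & ~~ A y]).
    by exists y.
  pose B := [pred x | (x \notin S) && ~~ A x].
  have cl : closed (remove_vertices e (S :\ s)) B.
    apply: (intro_closed (Dsym _)) => x y /and3P[xS' yS' exy] /andP[/= xS Ax].
    have ys : y != s.
      by apply: contraFneq (none x) => <-; rewrite es exy xS.
    have yS := notS _ yS' ys; rewrite inE /= yS; apply: contraNN Ax => Ay.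
    by apply: (AD y) => //; rewrite es.
  have := closed_connect cl con; rewrite !inE vS uS /=.
  by rewrite [A u]connect0 /= => /esym/negbFE; rewrite /A (negPf nc).
have [s sS] : exists s, s \in S.
  apply/set0Pn; apply: contraNneq nc => S0.
  rewrite (eq_connect (e' := e)) ?triangulation_connected // => x y.
  by rewrite /D S0 /remove_vertices /= !inE.
(* Successive neighbours of [x] are adjacent, so the rotation can leave either side only by entering
   [S]. *)
have links x : x \in S -> exists p q, [/\ e x p, A p & r x p \in S] /\
    [/\ e x q, q \notin S, ~~ A q & r x q \in S].
  move=> xS; have [[a exa Aa] [b [exb bS Ab]]] := sides x xS.
  have [p /and3P[exp Ap rp]|none] := pickP
      (fun p => [&& e x p, A p & r x p \in S]); last first.
    suff /andP[Ab' _] : A b && e x b by rewrite Ab' in Ab.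
    apply: (nbr_ind (Q := fun y => A y && e x y) _ _ exa exb); last by rewrite Aa.
    move=> y /andP[Ay exy]; rewrite rot_adj // andbT; apply: (AD y) => //.
      by have := none y; rewrite exy Ay /= => ->.
    exact: rot_nbr_adj.
  have [q /and4P[exq qS Aq rq]|none'] := pickP
      (fun q => [&& e x q, q \notin S, ~~ A q & r x q \in S]).
    by exists p, q.
  suff /and3P[_ _ Aa'] : [&& e x a, a \notin S & ~~ A a] by rewrite Aa in Aa'.
  apply: (nbr_ind (Q := fun y => [&& e x y, y \notin S & ~~ A y]) _ _ exb exa).
    move=> y /and3P[exy yS Ay].
    have rS : r x y \notin S by have := none' y; rewrite exy yS Ay /= => ->.
    rewrite rot_adj // rS; apply: contraNN Ay => Ar; apply: (AD (r x y)) => //.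
    by rewrite es rot_nbr_adj.
  by rewrite exb bS.
have [p [q [[esp Ap tS] [esq qS Aq t'S]]]] := links s sS.
set t := r s p in tS; set t' := r s q in t'S.
have est : e s t := rot_adj esp; have est' : e s t' := rot_adj esq.
have pq : p != q by apply: contraNneq Aq => <-.
have tt' : t != t' by rewrite (inj_eq perm_inj).
have SE : [set s; t; t'] = S.
  apply/eqP; rewrite eqEcard; apply/andP; split.
    by apply/subsetP => x; rewrite !inE -orbA => /or3P[]/eqP->.
  rewrite -setUA !cardsU1 !inE cards1 negb_or.
  by rewrite (adj_neq est) (adj_neq est') tt'.
have [a [b [[eta Aa aS] [etb bS Ab b'S]]]] := links t tS.
(* The rotation at [t] meets [S] in two distinct neighbours of [t], which must be [s] and [t']. *)
have ett' : e t t'.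
  have eta' := rot_adj eta; have etb' := rot_adj etb.
  have ab : r t a != r t b.
    by rewrite (inj_eq perm_inj); apply: contraNneq Ab => <-.
  move: aS b'S; rewrite -SE !inE -!orbA.
  case/or3P=> /eqP ea; rewrite ea ?ei // in eta' ab *.
  case/or3P=> /eqP eb; rewrite eb ?ei ?eqxx // in etb' ab *.
(* Being a face, the triangle makes [t] and [t'] consecutive around [s]; but their predecessors
   there are [p] and [q], outside [S]. *)
case/andP: (triangle_facial est est' ett') => _ /orP[]/eqP/perm_inj E.
  by move: qS; rewrite -E tS.
by move: (AS _ Ap); rewrite -E t'S.
Qed.

End Triangulations.

Theorem theorem2 (T : finType) (e : rel T)
    (he : simple_graph e)
    (htri : planar_triangulation e)
    (hcard : 5 <= #|T|)
    (hcol : exists (C : eqType) (c : {set T} -> C),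
        proper_edge_coloring e c /\ ~ has_rainbow_C4 e c) :
  min_degree_is e 5 /\ k_connected 4 e.
Proof.
case: htri => -[r0 [rot0 eu0]] max; case: hcol => C [c [proper norainbow]].
have [r hr rr0] := reduce_rotation rot0.
have eu : euler e r.
  rewrite /euler /euler_count -eu0; congr (_ + _).
  have := facesE he.1 hr rr0; rewrite -(facesE he.1 hr (fun _ _ _ => erefl)).
  by move/addIn.
have hmax u v r' : u != v -> ~~ e u v ->
    reduced_rotation (add_edge e u v) r' -> ~ euler (add_edge e u v) r'.
  move=> uv nuv [rot' _] eu'.
  have sub : subrel e (add_edge e u v) by move=> x y exy; rewrite /add_edge /= exy.
  have planar' : planar (add_edge e u v) by exists r'.
  have := max _ (add_edge_simple he uv) sub planar' u v.
  by rewrite (negPf nuv) /add_edge /= !eqxx orbT.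
have deg5 := deg_ge5 he hr eu hmax hcard proper norainbow.
split.
  split=> //; have [v lt6] := ex_deg_lt6 he hr eu hmax hcard.
  by exists v; apply/eqP; rewrite eqn_leq -ltnS lt6 deg5.
split=> // S ltS u v uS vS.
exact: (small_set_not_separating he hr eu hmax hcard proper norainbow).
Qed.
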